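(* Let $\vec{G_0}$ be a difference distance magic oriented graph (DDMOG) with $n$ vertices, and let $s\in\{2,3,4,5,6\}$. Let $L$ be an integer such that $a_s\le L\le b_s$, where the bounds $a_s$, $b_s$ and the associated list of node labels are: - $s=2$: $a_2=3$, $b_2=n+2$; node labels $2,\ L-2$. - $s=3$: $a_3=6$, $b_3=n+5$; node labels $4,\ L-5,\ L-3$; in this case $L$ is additionally assumed to be even. - $s=4$: $a_4=6$, $b_4=n+2$; node labels $1,\ 2,\ 3,\ L-2$. - $s=5$: $a_5=7$, $b_5=n+3$; node labels $1,\ 2,\ 3,\ L-3,\ L-2$. - $s=6$: $a_6=8$, $b_6=n+3$; node labels $1,\ 2,\ 3,\ 4,\ L-3,\ L-2$. Let $H=4C_L$ be the disjoint union of four cycles of length $L$. Then there exists an orientation $\vec{H}$ of $H$, paired with a labeling function $h$, such that (a) the oriented graph $\vec{H}$ is an $s$-nodes ornament, where the labels of the nodes are as listed above for the given $s$; and (b) the weighted sum $\vec{G}:=\vec{G_0}\oplus_{\mathrm{wt}_h}\vec{H}$ is a DDMOG.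
   Context: All graphs are finite and simple. An oriented graph is a directed graph in which $(u,v)$ being an edge implies that $(v,u)$ is not an edge; an orientation of an undirected graph is an oriented graph whose underlying graph is that graph. Oriented cycles are always such that every vertex has exactly one incoming and one outgoing edge (different copies of a cycle may be oriented oppositely). **Labeling and weight.** A labeling function of a graph is a bijection from its vertex set onto some set of integers. For an oriented graph with labeling function $f$, the weight of a vertex $x$ is $\mathrm{wt}_f(x)=\sum_{y:\,(y,x)\text{ is an edge}} f(y)-\sum_{y:\,(x,y)\text{ is an edge}} f(y)$. **DDMOG.** A difference distance magic (DDM) labeling of an oriented graph $\vec G$ on $n$ vertices is a bijection $f:V(\vec G)\to\{1,\dots,n\}$ such that $\mathrm{wt}_f(x)$ has the same value for all vertices $x$ (this value is then necessarily $0$). An oriented graph that has a DDM labeling is called a difference distance magic oriented graph (DDMOG). Edgeless graphs are trivial examples. **Weighted sum.** Let $\vec G$ be an oriented graph with vertices $v_1,\dots,v_n$ and labeling $g(v_i)=i$ (for a DDMOG, its DDM labeling), and let $\vec H$ be a separate oriented graph with labeling $h:V(\vec H)\to\mathbb{Z}^+$ such that $\{|\mathrm{wt}_h(u)|:u\in V(\vec H)\}\subseteq\{0\}\cup\{g(v):v\in V(\vec G)\}$. The weighted sum $\vec G\oplus_{\mathrm{wt}_h}\vec H$ is the oriented graph with vertex set $V(\vec G)\cup V(\vec H)$ whose edges are those of $\vec G$ and of $\vec H$ together with, for each $1\le i\le n$, all edges $(v_i,u)$ with $u\in V(\vec H)$, $\mathrm{wt}_h(u)=-i$, and all edges $(u,v_i)$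 with $u\in V(\vec H)$, $\mathrm{wt}_h(u)=i$. **Ornaments and nodes.** For two separate graphs $\vec G$ and $\vec H$, $\vec H$ is attached to $\vec G$ when one or more oriented edges are introduced between some vertices of $\vec G$ and some vertices of $\vec H$. A vertex of $\vec G$ that has multiple vertices of $\vec H$ attached to it is called a node. An ornament $\vec H$ is an oriented graph that can be attached to a DDMOG $\vec G$ in such a way that the resulting graph has a DDM labeling, while preserving the initial DDM labeling of $\vec G$. If $s$ vertices of the DDMOG $\vec G$ are to be attached to multiple vertices of the ornament $\vec H$, then $\vec H$ is called an $s$-nodes ornament. The label of a node is its label under the DDM labeling of $\vec G$.
   Formalization: The listed node labels are assumed to be labels of vertices of G_0 (the bounds allow labels above n, e.g. s=5, L=n+3, where the claim fails); for s=2, L=4 both listed labels equal 2, so the ornament has one node instead of two. *)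

(* Defs.v *)
From mathcomp Require Import all_boot all_order all_algebra.
Set Implicit Arguments.
Unset Strict Implicit.
Unset Printing Implicit Defensive.
Import Order.TTheory GRing.Theory Num.Theory.
Local Open Scope ring_scope.

(* A directed graph is a relation [e] on a finite vertex type; [e x y] means
   that (x,y) is an edge, directed from x to y. *)

(* The case [x = y] rules out loops. *)
Definition oriented (V : finType) (e : rel V) : Prop :=
  forall x y, e x y -> ~~ e y x.

Definition orientation_of (V : finType) (adj e : rel V) : Prop :=
  oriented e /\ (forall x y, adj x y = e x y || e y x).

Definition cyclically_oriented (V : finType) (e : rel V) : Prop :=
  forall x, #|[set y | e y x]| = 1%N /\ #|[set y | e x y]| = 1%N.

(* A bijection from V onto some set of integers is an injective function. *)
Definition labeling (V : finType) (f : V -> int) : Prop := injective f.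

Definition wt (V : finType) (e : rel V) (f : V -> int) (x : V) : int :=
  \sum_(y | e y x) f y - \sum_(y | e x y) f y.

Definition ddm_labeling (V : finType) (e : rel V) (f : V -> int) : Prop :=
  [/\ labeling f,
      forall k : int, (exists x, f x = k) <-> (1 <= k <= #|V|%:Z)
    & forall x y, wt e f x = wt e f y].

Definition ddmog (V : finType) (e : rel V) : Prop :=
  oriented e /\ exists f : V -> int, ddm_labeling e f.

Section WeightedSum.
Variables (V W : finType) (eV : rel V) (g : V -> int)
          (eW : rel W) (h : W -> int).

Definition weighted_sum_defined : Prop :=
  [/\ labeling h, forall u, 0 < h u
    & forall u, wt eW h u = 0 \/ exists v, `|wt eW h u| = g v].

Definition weighted_sum : rel (V + W)%type := fun a b =>
  match a, b with
  | inl v, inl v' => eV v v'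
  | inr u, inr u' => eW u u'
  | inl v, inr u => wt eW h u == - g v
  | inr u, inl v => wt eW h u == g v
  end.

End WeightedSum.

Section Ornaments.
Variables (V W : finType) (eV : rel V) (g : V -> int) (eW : rel W).

(* [e] is obtained from the disjoint union of [eV] and [eW] by adding one or
   more oriented edges between V and W. *)
Definition attachment (e : rel (V + W)%type) : Prop :=
  [/\ oriented e,
      forall v v', e (inl v) (inl v') = eV v v',
      forall u u', e (inr u) (inr u') = eW u u'
    & exists v u, e (inl v) (inr u) || e (inr u) (inl v)].

Definition ornament_attachment (e : rel (V + W)%type) : Prop :=
  attachment e /\
  exists f : (V + W)%type -> int,
    ddm_labeling e f /\ (forall v, f (inl v) = g v).

Definition nodes (e : rel (V + W)%type) : {set V} :=
  [set v | (1 < #|[set u | e (inl v) (inr u) || e (inr u) (inl v)]|)%N].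

(* [eW] is an s-nodes ornament of the graph [eV] with DDM labeling [g], attached
   to it as in [e]. *)
Definition s_nodes_ornament (e : rel (V + W)%type) (s : nat) : Prop :=
  ornament_attachment e /\ #|nodes e| = s.

Definition node_labels (e : rel (V + W)%type) (k : int) : Prop :=
  exists2 v, v \in nodes e & g v = k.

End Ornaments.

(* Four disjoint cycles of length L >= 3: the vertex (c, i) is the i-th vertex
   of the c-th cycle, and [ordS] is the cyclic successor in 'I_L. *)
Definition four_cycles (L : nat) : rel ('I_4 * 'I_L) := fun x y =>
  (x.1 == y.1) && ((y.2 == ordS x.2) || (x.2 == ordS y.2)).

Definition L_min (s : nat) : nat :=
  match s with 2 => 3 | 3 => 6 | 4 => 6 | 5 => 7 | 6 => 8 | _ => 0 end%N.

Definition L_max (s n : nat) : nat :=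
  match s with
  | 2 => n + 2 | 3 => n + 5 | 4 => n + 2 | 5 => n + 3 | 6 => n + 3 | _ => 0
  end%N.

Definition listed_labels (s L : nat) : seq int :=
  match s with
  | 2 => [:: 2; L%:Z - 2]
  | 3 => [:: 4; L%:Z - 5; L%:Z - 3]
  | 4 => [:: 1; 2; 3; L%:Z - 2]
  | 5 => [:: 1; 2; 3; L%:Z - 3; L%:Z - 2]
  | 6 => [:: 1; 2; 3; 4; L%:Z - 3; L%:Z - 2]
  | _ => [::]
  end.

(* The listed labels are pairwise distinct, except that for s = 2 and L = 4
   both of them are 2, so that only one vertex can carry them. *)
Definition node_count (s L : nat) : nat :=
  if (s == 2%N) && (L == 4%N) then 1%N else s.

(* Main.v *)
Require Import Defs.
From mathcomp Require Import all_boot all_order all_algebra.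
From mathcomp Require Import zify ring.
Set Implicit Arguments.
Unset Strict Implicit.
Unset Printing Implicit Defensive.
Import Order.TTheory GRing.Theory Num.Theory.
Local Open Scope ring_scope.

(* Label cycle c (c = 0..3) by n + 1 + cL + p(i), where p permutes 0..L-1, and
   direct the cycles +, -, -, +.  The weight of a cycle vertex is then
   +/- (p(i) - p(i+2)), so the attached nodes are those whose labels are the
   cyclic two-step differences |p(i) - p(i+2)|.  The contributions of the four
   cycles to a node cancel because 0 - 1 - 2 + 3 = 0 and 1 - 1 - 1 + 1 = 0, and
   the edges of the weighted sum annihilate the weights of cycle vertices.  It
   remains to find, for each s, a p whose set of two-step differences is the
   list of node labels: the identity gives {2, L-2}, and small perturbations of
   it give the lists for s = 4, 5, 6. *)

(** * Labels and weights in a difference distance magic graph *)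

Lemma inj_int_interval_onto (T : finType) (f : T -> int) :
  injective f -> (forall x, 1 <= f x <= #|T|%:Z) ->
  forall k : int, (exists x, f x = k) <-> (1 <= k <= #|T|%:Z).
Proof.
move=> f_inj f_rng k; split=> [[x <-]//|/andP[k1 kT]].
have idx_lt x : (`|f x - 1| < #|T|)%N by have := f_rng x; lia.
pose idx x := Ordinal (idx_lt x).
have idx_inj : injective idx.
  move=> x y /(congr1 val) /= exy; apply: f_inj.
  by have := f_rng x; have := f_rng y; lia.
have k_lt : (`|k - 1| < #|T|)%N by lia.
have /codomP[x /(congr1 val) /= ex] : Ordinal k_lt \in codom idx.
  by apply: inj_card_onto; rewrite // card_ord.
by exists x; have := f_rng x; lia.
Qed.

(** Each edge (y, x) contributes the product [f y * f x] twice, with sign plus at its head and minus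
    at its tail. *)
Lemma weighted_wt_sum (V : finType) (e : rel V) (f : V -> int) :
  \sum_x f x * wt e f x = 0.
Proof.
under eq_bigr => x _ do rewrite /wt mulrBr !big_distrr /=.
rewrite sumrB; apply/eqP; rewrite subr_eq0; apply/eqP.
under eq_bigr => x _ do rewrite big_mkcond.
under [RHS]eq_bigr => x _ do rewrite big_mkcond.
rewrite exchange_big; apply: eq_bigr => x _; apply: eq_bigr => y _.
by rewrite mulrC.
Qed.

Lemma ddm_label_gt0 (V : finType) (e : rel V) (f : V -> int) x :
  ddm_labeling e f -> 0 < f x.
Proof.
by case=> _ f_rng _; have /andP[] := (f_rng (f x)).1 (ex_intro _ x erefl).
Qed.

(** A constant weight factors out of [weighted_wt_sum], leaving the sum of the labels, which is
    positive. *)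
Lemma ddm_wt0 (V : finType) (e : rel V) (f : V -> int) x :
  ddm_labeling e f -> wt e f x = 0.
Proof.
move=> ddm_f; have [_ _ wt_const] := ddm_f.
have := weighted_wt_sum e f.
under eq_bigr => y _ do rewrite (wt_const y x).
rewrite -big_distrl /= => /eqP; rewrite mulf_eq0 => /orP[|/eqP//].
rewrite (bigD1 x) //= gt_eqF // ltr_wpDr ?(ddm_label_gt0 _ ddm_f) //.
by apply: sumr_ge0 => y _; apply/ltW/(ddm_label_gt0 _ ddm_f).
Qed.

(** Labels are positive and distinct, so exactly one of the two sums is nonempty, and it has a
    single term. For [t] the weight of a vertex, this is what its attached edges add. *)
Lemma signed_label_sum (V : finType) (g : V -> int) (t : int) :
  injective g -> (forall v, 0 < g v) -> (exists v, `|t| = g v) ->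
  \sum_(v | t == - g v) g v - \sum_(v | t == g v) g v = - t.
Proof.
move=> g_inj g_gt0 [v0 tv0].
have [t_ge0|t_lt0] := leP 0 t.
  rewrite big1 => [|v /eqP tv]; last by have := g_gt0 v; lia.
  rewrite (big_pred1 v0) => [|v /=]; first by lia.
  by rewrite -(inj_eq g_inj) -tv0 ger0_norm // eq_sym.
rewrite (big_pred1 v0) => [|v /=].
  by rewrite big1 => [|v /eqP tv]; [lia | have := g_gt0 v; lia].
by rewrite -(inj_eq g_inj) -tv0 ltr0_norm // eq_sym -eqr_oppLR.
Qed.

(** * Weights in a weighted sum *)

Lemma wt_weighted_sum_inl (V W : finType) (eV : rel V) (g : V -> int)
    (eW : rel W) (h : W -> int) (f : V + W -> int) v :
  (forall v, f (inl v) = g v) -> (forall u, f (inr u) = h u) ->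
  wt (weighted_sum eV g eW h) f (inl v) =
  wt eV g v + (\sum_(u | wt eW h u == g v) h u
               - \sum_(u | wt eW h u == - g v) h u).
Proof.
move=> fg fh; rewrite {1}/wt !big_sumType /=.
under eq_bigr => x _ do rewrite fg.
under [X in _ + X - _]eq_bigr => x _ do rewrite fh.
under [X in _ - (X + _)]eq_bigr => x _ do rewrite fg.
under [X in _ - (_ + X)]eq_bigr => x _ do rewrite fh.
by rewrite /wt; ring.
Qed.

Lemma wt_weighted_sum_inr (V W : finType) (eV : rel V) (g : V -> int)
    (eW : rel W) (h : W -> int) (f : V + W -> int) u :
  (forall v, f (inl v) = g v) -> (forall u, f (inr u) = h u) ->
  wt (weighted_sum eV g eW h) f (inr u) =
  wt eW h u + (\sum_(v | wt eW h u == - g v) g v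
               - \sum_(v | wt eW h u == g v) g v).
Proof.
move=> fg fh; rewrite {1}/wt !big_sumType /=.
under eq_bigr => x _ do rewrite fg.
under [X in _ + X - _]eq_bigr => x _ do rewrite fh.
under [X in _ - (X + _)]eq_bigr => x _ do rewrite fg.
under [X in _ - (_ + X)]eq_bigr => x _ do rewrite fh.
by rewrite {3 4}/wt; ring.
Qed.

Lemma weighted_sum_oriented (V W : finType) (eV : rel V) (g : V -> int)
    (eW : rel W) (h : W -> int) :
  (forall v, 0 < g v) -> oriented eV -> oriented eW ->
  oriented (weighted_sum eV g eW h).
Proof.
move=> g_gt0 oV oW [v|u] [v'|u'] /=; [exact: oV | | | exact: oW].
  by move/eqP->; have := g_gt0 v; lia.
by move/eqP->; have := g_gt0 v'; lia.
Qed.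

(** Old vertices keep weight 0 by the balance hypothesis; new ones get weight 0 by
    [signed_label_sum]. *)
Lemma weighted_sum_ddm (V W : finType) (eV : rel V) (g : V -> int)
    (eW : rel W) (h : W -> int) :
  ddm_labeling eV g -> injective h ->
  (forall u, #|V|%:Z < h u <= #|V|%:Z + #|W|%:Z) ->
  (forall u, exists v, `|wt eW h u| = g v) ->
  (forall v, \sum_(u | wt eW h u == g v) h u
             = \sum_(u | wt eW h u == - g v) h u) ->
  exists f : V + W -> int,
    ddm_labeling (weighted_sum eV g eW h) f /\ (forall v, f (inl v) = g v).
Proof.
move=> ddm_g h_inj h_rng h_wt h_bal; have [g_inj g_rng _] := ddm_g.
have gP v : 1 <= g v <= #|V|%:Z by apply/g_rng; exists v.
exists (fun x => match x with inl v => g v | inr u => h u end); split=> //.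
have wt0 x : wt (weighted_sum eV g eW h)
    (fun x => match x with inl v => g v | inr u => h u end) x = 0.
  case: x => [v|u].
    rewrite (@wt_weighted_sum_inl _ _ _ g _ h) // (ddm_wt0 _ ddm_g) h_bal.
    by ring.
  rewrite (@wt_weighted_sum_inr _ _ _ g _ h) // signed_label_sum ?subrr //.
  by move=> v; exact: ddm_label_gt0 ddm_g.
have f_inj : injective (fun x => match x with inl v => g v | inr u => h u end).
  move=> [v|u] [v'|u'] /=; [by move/g_inj-> | | | by move/h_inj->].
    by have := gP v; have := h_rng u'; lia.
  by have := gP v'; have := h_rng u; lia.
split=> //; last by move=> x y; rewrite !wt0.
apply: inj_int_interval_onto => // -[v|u]; rewrite card_sum PoszD.
  by have := gP v; lia.
by have := h_rng u; lia.
Qed.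

(** * Orientation and labeling of the four cycles *)

Lemma ordS2_neq L (i : 'I_L) : (2 < L)%N -> ordS (ordS i) != i.
Proof.
move=> L2; apply/eqP => /(congr1 val) /=; rewrite -addn1 modnDml addn1 -addn1.
case: i => i /= iL; have [|] := ltnP (i.+1 + 1) L => h.
  by rewrite modn_small //; lia.
have -> : (i.+1 + 1 = (i.+2 - L) + L)%N by lia.
by rewrite modnDr modn_small; lia.
Qed.

Definition flipped (c : 'I_4) : bool := (c == 1 :> nat)%N || (c == 2 :> nat)%N.

(* pmmp: the directions plus, minus, minus, plus of cycles 0, 1, 2, 3. *)
Definition pmmp_orientation L : rel ('I_4 * 'I_L) := fun x y =>
  (x.1 == y.1) && (if flipped x.1 then x.2 == ordS y.2 else y.2 == ordS x.2).

Definition pmmp_labeling (n L : nat) (p : nat -> nat) (x : 'I_4 * 'I_L) : int :=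
  (n + x.1 * L + p x.2).+1%:Z.

Definition step2 (L : nat) (p : nat -> nat) (i : nat) : int :=
  (p i)%:Z - (p (i.+2 %% L)%N)%:Z.

(** [p] lives on [nat] and is constrained only below [L], so concrete permutations can be given by
    plain arithmetic. *)
Definition arrangement (L : nat) (p : nat -> nat) (D : seq int) : Prop :=
  [/\ forall i, (i < L)%N -> (p i < L)%N,
      forall i j, (i < L)%N -> (j < L)%N -> p i = p j -> i = j,
      forall i, (i < L)%N -> `|step2 L p i| \in D
    & forall k, k \in D -> exists2 i, (i < L)%N & `|step2 L p i| = k].

Lemma pmmp_out L (x y : 'I_4 * 'I_L) : pmmp_orientation x y =
  (y == (x.1, if flipped x.1 then ord_pred x.2 else ordS x.2)).
Proof.
rewrite /pmmp_orientation -pair_eqE /= [x.1 == _]eq_sym.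
case: eqP => //= _; case: ifP => // _.
by rewrite -[RHS](inj_eq (@ordS_inj L)) ord_predK eq_sym.
Qed.

Lemma pmmp_in L (x y : 'I_4 * 'I_L) : pmmp_orientation y x =
  (y == (x.1, if flipped x.1 then ordS x.2 else ord_pred x.2)).
Proof.
rewrite /pmmp_orientation -pair_eqE /=.
case: eqP => //= ->; case: ifP => // _.
by rewrite -[RHS](inj_eq (@ordS_inj L)) ord_predK eq_sym.
Qed.

Lemma pmmp_orientation_of L :
  (2 < L)%N -> orientation_of (@four_cycles L) (@pmmp_orientation L).
Proof.
move=> L2; split=> x y.
  rewrite pmmp_out => /eqP->; rewrite pmmp_out -pair_eqE /=; apply/negP.
  case/andP=> _; case: (flipped x.1) => /eqP e.
    have := ordS2_neq (ord_pred (ord_pred x.2)) L2.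
    by rewrite !ord_predK -e eqxx.
  by have := ordS2_neq x.2 L2; rewrite -e eqxx.
rewrite /four_cycles /pmmp_orientation [y.1 == _]eq_sym.
by case: eqP => //= ->; case: ifP; rewrite // orbC.
Qed.

Lemma pmmp_cyclic L : cyclically_oriented (@pmmp_orientation L).
Proof.
move=> x; split; apply/eqP/cards1P; eexists; apply/setP => y.
  by rewrite !inE pmmp_in.
by rewrite !inE pmmp_out.
Qed.

(** The neighbours of position i + 1 are i and i + 2, hence the shift by [ord_pred]; flipping a
    cycle exchanges its in- and out-neighbours. *)
Lemma pmmp_wt (n L : nat) p (x : 'I_4 * 'I_L) :
  wt (@pmmp_orientation L) (pmmp_labeling n p) x =
  (-1) ^+ flipped x.1 * step2 L p (ord_pred x.2).
Proof.
rewrite /wt (big_pred1 _ (fun y => pmmp_in x y)).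
rewrite (big_pred1 _ (fun y => pmmp_out x y)) /pmmp_labeling /step2 /=.
have -> : (((x.2 + L).-1 %% L).+2 %% L = ordS x.2)%N.
  by rewrite -[in RHS](ord_predK x.2) /= -[in RHS]addn1 modnDml addn1.
by case: ifP => _ /=; rewrite ?expr1 ?expr0 ?mulN1r ?mul1r; lia.
Qed.

Lemma sum_pmmp_labeling (n L : nat) p (i : 'I_L) :
  \sum_c (-1) ^+ flipped c * pmmp_labeling n p (c, i) = 0.
Proof.
rewrite !big_ord_recl big_ord0 /pmmp_labeling /flipped /= /bump /=.
by rewrite !expr0 !expr1; lia. Qed.

(** At a fixed position the four weights agree up to the sign of the cycle, so the difference of the
    two indicators is a common factor [F] times that sign, and [sum_pmmp_labeling] applies position
    by position. *)
Lemma pmmp_balanced (n L : nat) p (k : int) :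
  let w := wt (@pmmp_orientation L) (pmmp_labeling n p) in
  \sum_(u | w u == k) pmmp_labeling n p u =
  \sum_(u | w u == - k) pmmp_labeling n p u.
Proof.
move=> w; apply/eqP; rewrite -subr_eq0 big_mkcond [X in _ - X]big_mkcond /=.
pose F (i : 'I_L) : int := (step2 L p (ord_pred i) == k)%:R
                         - (step2 L p (ord_pred i) == - k)%:R.
rewrite -sumrB (eq_bigr (fun u : 'I_4 * 'I_L =>
  F u.2 * ((-1) ^+ flipped u.1 * pmmp_labeling n p (u.1, u.2)))).
  rewrite -(pair_bigA _ (fun c i =>
    F i * ((-1) ^+ flipped c * pmmp_labeling n p (c, i)))) exchange_big /=.
  by rewrite big1 // => i _; rewrite -big_distrr /= sum_pmmp_labeling mulr0.
move=> [c i] _; rewrite /w pmmp_wt /F /=; case: (flipped c) => /=.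
  by rewrite expr1 mulN1r eqr_oppLR eqr_opp; do 2!case: (_ == _) => /=; lia.
by rewrite expr0 mul1r; do 2!case: (_ == _) => /=; lia.
Qed.

Lemma pmmp_labeling_inj (n L : nat) p (D : seq int) :
  arrangement L p D -> injective (@pmmp_labeling n L p).
Proof.
case=> p_lt p_inj _ _ [c i] [d j]; rewrite /pmmp_labeling /= => -[].
have := p_lt _ (ltn_ord i); have := p_lt _ (ltn_ord j) => pj pi.
rewrite -!addnA => /addnI e; have L0 : (0 < L)%N by lia.
(* Since [p] stays below [L], division by [L] recovers the cycle index. *)
have ecd : c = d :> nat.
  by have := congr1 (divn^~ L) e; rewrite !divnMDl // !divn_small // !addn0.
move: e; rewrite ecd => /addnI /p_inj eij.
by congr pair; apply: val_inj => //=; apply: eij.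
Qed.

(** * From an arrangement to an ornament *)

Lemma pmmp_ornament (V : finType) (e0 : rel V) (g : V -> int) (L : nat) p
    (D : seq int) :
  oriented e0 -> ddm_labeling e0 g -> (2 < L)%N -> arrangement L p D ->
  (forall k, k \in D -> exists v, g v = k) ->
  exists (eH : rel ('I_4 * 'I_L)%type) (h : 'I_4 * 'I_L -> int),
    [/\ orientation_of (@four_cycles L) eH,
        cyclically_oriented eH,
        weighted_sum_defined g eH h,
        s_nodes_ornament e0 g eH (weighted_sum e0 g eH h) (size (undup D)) /\
        (forall k, node_labels g (weighted_sum e0 g eH h) k <-> k \in D)
      & ddmog (weighted_sum e0 g eH h)].
Proof.
move=> or_e0 ddm_g L2 arr_p hD; have [p_lt p_inj p_in p_onto] := arr_p.
have [g_inj g_rng _] := ddm_g.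
have g_gt0 v : 0 < g v by exact: ddm_label_gt0 ddm_g.
pose h := @pmmp_labeling #|V| L p; exists (@pmmp_orientation L), h.
have or_H := pmmp_orientation_of L2.
have h_inj : injective h := pmmp_labeling_inj arr_p.
have abs_wt u : `|wt (@pmmp_orientation L) h u| = `|step2 L p (ord_pred u.2)|.
  by rewrite pmmp_wt normrMsign.
have wtD u : `|wt (@pmmp_orientation L) h u| \in D.
  by rewrite abs_wt p_in // ltn_ord.
have [f [ddm_f fg]] : exists f : V + 'I_4 * 'I_L -> int,
    ddm_labeling (weighted_sum e0 g (@pmmp_orientation L) h) f /\
    (forall v, f (inl v) = g v).
  apply: weighted_sum_ddm => //.
  - move=> [c i]; rewrite /h /pmmp_labeling card_prod !card_ord /=.
    have := p_lt _ (ltn_ord i); have := ltn_ord c; nia.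
  - by move=> u; have [v gv] := hD _ (wtD u); exists v.
  - by move=> v; exact: pmmp_balanced.
have or_G : oriented (weighted_sum e0 g (@pmmp_orientation L) h).
  by apply: weighted_sum_oriented => //; have [] := or_H.
have attach v u : weighted_sum e0 g (@pmmp_orientation L) h (inl v) (inr u)
    || weighted_sum e0 g (@pmmp_orientation L) h (inr u) (inl v)
    = (`|wt (@pmmp_orientation L) h u| == g v).
  by rewrite /= eqr_norml (ltW (g_gt0 v)) andbT orbC.
have nodeE v : (v \in nodes (weighted_sum e0 g (@pmmp_orientation L) h))
    = (g v \in D).
  rewrite inE; apply/idP/idP => [|/p_onto[i iL ei]].
    case/ltnW/card_gt0P=> u; rewrite inE attach => /eqP <-; exact: wtD.
  (* All cycles carry the same [p], so one position realising the difference gives a neighbour in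
     every cycle; [ordS] undoes the shift in [pmmp_wt]. *)
  pose u c : 'I_4 * 'I_L := (c, ordS (Ordinal iL)).
  have nu c : u c \in [set u | weighted_sum e0 g (@pmmp_orientation L) h
      (inl v) (inr u) || weighted_sum e0 g (@pmmp_orientation L) h
      (inr u) (inl v)].
    by rewrite inE attach abs_wt [ord_pred _](ordSK (Ordinal iL)) ei.
  by apply/card_gt1P; exists (u 0), (u 1).
have nodes_card : #|nodes (weighted_sum e0 g (@pmmp_orientation L) h)|
    = size (undup D).
  rewrite cardE -(size_map g); apply/perm_size/uniq_perm.
  - by rewrite map_inj_uniq ?enum_uniq.
  - exact: undup_uniq.
  - move=> k; rewrite mem_undup; apply/mapP/idP => [[v]|kD].
      by rewrite mem_enum nodeE => vD ->.
    have [v gv] := hD k kD; exists v => //.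
    by rewrite mem_enum nodeE gv.
split=> //.
- exact: pmmp_cyclic.
- split=> // u; right; have [v gv] := hD _ (wtD u); by exists v.
- split.
    split=> //; split; last by exists f.
    split=> //; have i0 : 'I_L by exists 0%N; lia.
    have [v gv] := hD _ (wtD (0, i0)); exists v, (0, i0).
    by rewrite attach gv.
  move=> k; split=> [[v]|kD]; first by rewrite nodeE => vD <-.
  by have [v gv] := hD k kD; exists v; rewrite ?nodeE gv.
- by split=> //; exists f.
Qed.


(** * Permutations with prescribed two-step differences *)

Lemma step2E (L : nat) p (i : nat) : (2 < L)%N -> (i < L)%N ->
  step2 L p i =
  if (i.+2 < L)%N then (p i)%:Z - (p i.+2)%:Z
  else (p i)%:Z - (p (i.+2 - L)%N)%:Z.
Proof.
move=> L2 iL; rewrite /step2; case: ltnP => h; first by rewrite modn_small.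
by rewrite -[in LHS](subnK h) modnDr modn_small; last lia.
Qed.

Lemma eq_arrangement (L : nat) p (D D' : seq int) :
  D =i D' -> arrangement L p D -> arrangement L p D'.
Proof.
by move=> eqD [? ? ? p_onto]; split=> // *; rewrite -?eqD;
  [auto | apply: p_onto; rewrite eqD].
Qed.

Ltac split_ifs := do ?[lia]; do ?case: ifP; lia.

Lemma id_arrangement (L : nat) :
  (2 < L)%N -> arrangement L id [:: 2; L%:Z - 2].
Proof.
move=> L2; split=> // [i iL | k].
  by rewrite step2E // !inE; split_ifs.
rewrite !inE => /orP[] /eqP->.
- by exists 0%N; rewrite ?step2E; split_ifs.
- by exists (L - 2)%N; rewrite ?step2E; split_ifs.
Qed.

(** Values 0, 2, 1, 3, 4, ...: the swap creates the differences 1 and 3, and the value 2 at position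
    1 turns one wrap-around difference into L - 3. *)
Definition swap12 (i : nat) : nat :=
  (if i == 1 then 2 else if i == 2 then 1 else i)%N.

Lemma swap12_arrangement (L : nat) :
  (5 < L)%N -> arrangement L swap12 [:: 1; 2; 3; L%:Z - 3; L%:Z - 2].
Proof.
move=> L5; split=> [i iL | i j iL jL | i iL | k].
- by rewrite /swap12; split_ifs.
- by rewrite /swap12; split_ifs.
- by rewrite step2E ?inE /swap12; split_ifs.
rewrite !inE => /or4P[| | |/orP[]] /eqP->.
- by exists 0%N; rewrite ?step2E /swap12 /=; split_ifs.
- by exists 3%N; rewrite ?step2E /swap12 /=; split_ifs.
- by exists 2%N; rewrite ?step2E /swap12 /=; split_ifs.
- by exists L.-1; rewrite ?step2E /swap12 /=; split_ifs.
- by exists L.-2; rewrite ?step2E /swap12 /=; split_ifs.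
Qed.

(** Values 0, 1, 3, 2, 4, ...: positions 0 and 1 are untouched, so both wrap-around differences
    remain L - 2. *)
Definition swap23 (i : nat) : nat :=
  (if i == 2 then 3 else if i == 3 then 2 else i)%N.

Lemma swap23_arrangement (L : nat) :
  (6 < L)%N -> arrangement L swap23 [:: 1; 2; 3; L%:Z - 2].
Proof.
move=> L6; split=> [i iL | i j iL jL | i iL | k].
- by rewrite /swap23; split_ifs.
- by rewrite /swap23; split_ifs.
- by rewrite step2E ?inE /swap23; split_ifs.
rewrite !inE => /or4P[] /eqP->.
- by exists 1%N; rewrite ?step2E /swap23 /=; split_ifs.
- by exists 4%N; rewrite ?step2E /swap23 /=; split_ifs.
- by exists 0%N; rewrite ?step2E /swap23 /=; split_ifs.
- by exists L.-2; rewrite ?step2E /swap23 /=; split_ifs.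
Qed.

(** Values 0, 2, 3, 1, 4, 5, ...: the value 1 at position 3 meets 5 and gives 4; the value 2 at
    position 1 gives L - 3. *)
Definition rot123 (i : nat) : nat :=
  (if i == 1 then 2 else if i == 2 then 3 else if i == 3 then 1 else i)%N.

Lemma rot123_arrangement (L : nat) :
  (7 < L)%N -> arrangement L rot123 [:: 1; 2; 3; 4; L%:Z - 3; L%:Z - 2].
Proof.
move=> L7; split=> [i iL | i j iL jL | i iL | k].
- by rewrite /rot123; split_ifs.
- by rewrite /rot123; split_ifs.
- by rewrite step2E ?inE /rot123; split_ifs.
rewrite !inE => /or4P[| | |/or3P[]] /eqP->.
- by exists 1%N; rewrite ?step2E /rot123 /=; split_ifs.
- by exists 4%N; rewrite ?step2E /rot123 /=; split_ifs.
- by exists 0%N; rewrite ?step2E /rot123 /=; split_ifs.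
- by exists 3%N; rewrite ?step2E /rot123 /=; split_ifs.
- by exists L.-1; rewrite ?step2E /rot123 /=; split_ifs.
- by exists L.-2; rewrite ?step2E /rot123 /=; split_ifs.
Qed.

(* For even [L] a step of two positions stays within a parity class of
   positions; each class runs through two residue classes mod 4 of values. *)
Definition residues0 (m i : nat) : nat :=
  (if i./2 < m then 4 * i./2 + 2 * odd i
   else 4 * (i./2 - m) + 2 * odd i + 1)%N.

(** Even positions take 0, 4, ..., then 1, 5, ...; odd ones take 2, 6, ..., then 3, 7, .... In both
    classes the jump between runs is L - 5 and the return to the start is L - 3. *)
Lemma residues0_arrangement (m : nat) : (1 < m)%N ->
  arrangement (4 * m) (residues0 m)
    [:: 4; (4 * m)%N%:Z - 5; (4 * m)%N%:Z - 3].
Proof.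
move=> m1; split=> [i iL | i j iL jL | i iL | k].
- by rewrite /residues0; split_ifs.
- by rewrite /residues0; split_ifs.
- by rewrite step2E ?inE /residues0; split_ifs.
rewrite !inE => /or3P[] /eqP->.
- by exists 0%N; rewrite ?step2E /residues0 /=; split_ifs.
- by exists (2 * m - 2)%N; rewrite ?step2E /residues0; split_ifs.
- by exists (4 * m - 2)%N; rewrite ?step2E /residues0; split_ifs.
Qed.

(** Even positions take 0, 4, ..., 4m, then 3, 7, ..., 4m - 1; odd ones take 1, 5, ..., 4m + 1, then
    2, 6, ..., 4m - 2. In the odd class the jump is L - 3 and the return L - 5. *)
Definition residues2 (m i : nat) : nat :=
  (if i./2 <= m then 4 * i./2 + odd i
   else 4 * (i./2 - m.+1) + 3 - odd i)%N.

Lemma residues2_arrangement (m : nat) : (0 < m)%N ->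
  arrangement (4 * m + 2) (residues2 m)
    [:: 4; (4 * m + 2)%N%:Z - 5; (4 * m + 2)%N%:Z - 3].
Proof.
move=> m1; split=> [i iL | i j iL jL | i iL | k].
- by rewrite /residues2; split_ifs.
- by rewrite /residues2; split_ifs.
- by rewrite step2E ?inE /residues2; split_ifs.
rewrite !inE => /or3P[] /eqP->.
- by exists 0%N; rewrite ?step2E /residues2 /=; split_ifs.
- by exists (2 * m)%N; rewrite ?step2E /residues2; split_ifs.
- by exists (4 * m)%N; rewrite ?step2E /residues2; split_ifs.
Qed.

(** * Choice of the permutation and count of the labels *)

Lemma listed_arrangement (s L : nat) :
  s \in [:: 2; 3; 4; 5; 6]%N -> (L_min s <= L)%N -> (s = 3%N -> ~~ odd L) ->
  exists p, arrangement L p (listed_labels s L).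
Proof.
rewrite !inE => /or4P[| | |/orP[]] /eqP-> /= hL odd_L.
- by exists id; exact: id_arrangement.
- have {}odd_L := odd_L erefl; pose m := (L %/ 4)%N.
  have [eL|eL] : L = (4 * m)%N \/ L = (4 * m + 2)%N by lia.
    by exists (residues0 m); rewrite eL; apply: residues0_arrangement; lia.
  by exists (residues2 m); rewrite eL; apply: residues2_arrangement; lia.
(* In [swap23] the difference 2 first arises between positions 4 and 6, too late for L = 6; there L
   - 3 = 3, so [swap12] yields the required set. *)
- have [L6|L_neq6] := eqVneq L 6%N; last first.
    by exists swap23; apply: swap23_arrangement; lia.
  exists swap12; apply: eq_arrangement (swap12_arrangement _); last by rewrite L6.
  by move=> k; rewrite L6 !inE; lia.
- by exists swap12; apply: swap12_arrangement; lia.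
- by exists rot123; exact: rot123_arrangement.
Qed.

(** For s at least 4 the lower bound on [L] keeps L - 3 or L - 2 above the constants; for s = 3 a
    coincidence would force L = 7 or L = 9, both odd. *)
Lemma size_undup_listed (s L : nat) :
  s \in [:: 2; 3; 4; 5; 6]%N -> (L_min s <= L)%N -> (s = 3%N -> ~~ odd L) ->
  size (undup (listed_labels s L)) = node_count s L.
Proof.
rewrite !inE => hs hL odd_L; rewrite /node_count.
have [/andP[/eqP-> /eqP->] //|not24] := boolP ((s == 2%N) && (L == 4%N)).
rewrite undup_id; case/or4P: hs hL odd_L not24 => [| | |/orP[]] /eqP-> //=;
  rewrite !inE; lia.
Qed.

(* [hlab]: the listed node labels are labels of vertices of the graph [e0]. *)
Theorem theorem2p1 (V : finType) (e0 : rel V) (n : nat) (hn : #|V| = n)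
    (e0_oriented : oriented e0) (g : V -> int) (hg : ddm_labeling e0 g)
    (s L : nat) (hs : s \in [:: 2; 3; 4; 5; 6]%N)
    (hL : (L_min s <= L <= L_max s n)%N)
    (hL3 : s = 3%N -> ~~ odd L)
    (hlab : forall k, k \in listed_labels s L -> exists v, g v = k) :
  exists (eH : rel ('I_4 * 'I_L)%type) (h : 'I_4 * 'I_L -> int),
    [/\ orientation_of (@four_cycles L) eH,
        cyclically_oriented eH,
        weighted_sum_defined g eH h,
        s_nodes_ornament e0 g eH (weighted_sum e0 g eH h) (node_count s L) /\
        (forall k, node_labels g (weighted_sum e0 g eH h) k <->
                   k \in listed_labels s L)
      & ddmog (weighted_sum e0 g eH h)].
Proof.
have L_ge : (L_min s <= L)%N by case/andP: hL.
have [p arr_p] := listed_arrangement hs L_ge hL3.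
rewrite -size_undup_listed //; apply: pmmp_ornament arr_p hlab => //.
by move: hs L_ge; rewrite !inE => /or4P[| | |/orP[]] /eqP-> /=; lia.
Qed.
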